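(* Let $T:I_0'\to I_0$ be an EMR transformation and let $\mu$ be an equilibrium state (a Gibbs measure) for a potential $\Phi$. Suppose that for $x\in I_0''$ the Markov pointwise dimension $\delta_\mu(x)$ and the Birkhoff average $\overline\Phi(x)$ exist. Then $\overline d_\mu(x)\le\delta_\mu(x)$.
   Context: $I=[0,1]$ and $I_0\subset I$ is an interval. An EMR transformation is here a map $T:I_0'\to I_0$, where $I_0'=\bigcup_{i\in\mathbb N}I_{1,i}$ for disjoint intervals $I_{1,i}\subset I_0$, each $T:I_{1,i}\to I_0$ is a diffeomorphism, $\inf\{|DT(x)|:x\in I_0'\}>1$, and $T$ has bounded distortion: there is $K>0$ such that $|DT(x)/DT(y)-1|\le K|x-y|$ for all $i$ and $x,y\in I_{1,i}$. $I_0''=\{x\in I_0':T^n(x)\in I_0'\text{ for all }n\ge1\}$. If $T^n(x)$ is defined, $I_n(x)$ denotes the $n$-cylinder at $x$, i.e. the maximal interval around $x$ such that $T^n:I_n(x)\to I_0$ is a diffeomorphism. $|\cdot|$ denotes Euclidean length. For an EMR transformation there is $K_1\ge1$ such that for all such $x,n$, $$\frac1{K_1}\le\frac{|I_n(x)|}{|DT^n(x)|^{-1}}\le K_1 .$$ Gibbs property: $\mu$ is a probability measure and there is $C\ge1$ such that for every $x\in I_0''$, every $n\in\mathbb N$ and all $y\in I_n(x)$ (for which the sum is defined), $$\frac1C\le\frac{\mu(I_n(x))}{\exp\left(-nP(\Phi)+\sum_{j=0}^{n-1}\Phi(T^j(y))\right)}\le C .$$ Here $P(\Phi)\in\mathbb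 R$ is the pressure of $\Phi$, i.e. of its symbolic version on the full-shift coding $T$ (of summable variations): $P(\Phi)=\lim_{n\to\infty}\frac1n\log\sum_{T^nx=x}\exp\left(\sum_{j=0}^{n-1}\Phi(T^jx)\right)$. $\overline\Phi(x)=\lim_{n\to\infty}\frac1n\sum_{j=0}^{n-1}\Phi(T^j(x))$ is the Birkhoff average at $x$, when this (finite) limit exists. $\delta_\mu(x)=\lim_{k\to\infty}\frac{\log\mu(I_k(x))}{\log|I_k(x)|}$ when the limit exists (Markov pointwise dimension). $\overline d_\mu(x)=\limsup_{r\to0}\frac{\log\mu(B(x,r))}{\log r}$ (upper pointwise dimension), where $B(x,r)$ is the ball of radius $r$ at $x$. *)

(* Defs.v *)
From mathcomp Require Import all_boot all_order all_algebra.
From mathcomp Require Import all_classical all_reals all_analysis.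
Set Implicit Arguments.
Unset Strict Implicit.
Unset Printing Implicit Defensive.
Import Order.TTheory GRing.Theory Num.Theory.
Import numFieldNormedType.Exports.
Local Open Scope classical_set_scope.
Local Open Scope ring_scope.

(* The intervals below may contain endpoints, and T may jump between adjacent
   branches: derivatives are therefore taken relative to a set A, so they are
   one-sided at an endpoint of an interval A. *)
Definition slope (R : realType) (f : R -> R) (x y : R) : R :=
  (f y - f x) / (y - x).

Definition derivable_within (R : realType) (A : set R) (f : R -> R) (x : R) :=
  cvg (slope f x y @[y --> within A x^']).

Definition derive_within (R : realType) (A : set R) (f : R -> R) (x : R) : R :=
  lim (slope f x y @[y --> within A x^']).

Definition C1_on (R : realType) (A : set R) (f : R -> R) :=
  (forall x, A x -> derivable_within A f x) /\
  {within A, continuous (derive_within A f)}.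

Definition diffeo (R : realType) (A B : set R) (f : R -> R) :=
  [/\ set_bij A B f, C1_on A f &
      exists g : R -> R, (forall x, A x -> g (f x) = x) /\ C1_on B g].

(* Partial maps are total functions R -> R whose values off their domain are
   irrelevant.  [dom1] is I_0', [domn n] is the domain of T^n, and [surv] is
   I_0''. *)
Definition dom1 (R : realType) (I1 : nat -> set R) : set R := \bigcup_i I1 i.

Definition domn (R : realType) (I1 : nat -> set R) (T : R -> R) (n : nat) :
  set R := [set x | forall j, (j < n)%N -> dom1 I1 (iter j T x)].

Definition surv (R : realType) (I1 : nat -> set R) (T : R -> R) : set R :=
  [set x | dom1 I1 x /\ forall n, (1 <= n)%N -> dom1 I1 (iter n T x)].

Record EMR (R : realType) (I0 : set R) (I1 : nat -> set R) (T : R -> R) :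
  Prop := {
  EMR_itv0 : is_interval I0 ;
  EMR_sub0 : I0 `<=` `[0, 1] ;
  EMR_itv1 : forall i, is_interval (I1 i) ;
  EMR_sub1 : forall i, I1 i `<=` I0 ;
  EMR_disj : trivIset setT I1 ;
  EMR_diffeo : forall i, diffeo (I1 i) I0 T ;
  EMR_expanding :
    1 < inf [set d | exists i x, I1 i x /\ d = `|derive_within (I1 i) T x|] ;
  EMR_distortion : exists2 K : R, 0 < K & forall i x y, I1 i x -> I1 i y ->
    `|derive_within (I1 i) T x / derive_within (I1 i) T y - 1| <= K * `|x - y|
}.

Definition branch (R : realType) (I0 : set R) (I1 : nat -> set R) (T : R -> R)
    (n : nat) (x : R) (J : set R) :=
  [/\ is_interval J, J x, J `<=` domn I1 T n & diffeo J I0 (iter n T)].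

Definition is_cylinder (R : realType) (I0 : set R) (I1 : nat -> set R)
    (T : R -> R) (n : nat) (x : R) (J : set R) :=
  branch I0 I1 T n x J /\
  forall J', branch I0 I1 T n x J' -> J `<=` J' -> J' = J.

(* I_n(x); the default set0 is only taken when T^n(x) is undefined. *)
Definition cylinder (R : realType) (I0 : set R) (I1 : nat -> set R)
    (T : R -> R) (n : nat) (x : R) : set R :=
  xget set0 [set J | is_cylinder I0 I1 T n x J].

Definition len (R : realType) (J : set R) : R := fine (lebesgue_measure J).

Definition birkhoff_sum (R : realType) (T Phi : R -> R) (n : nat) (x : R) : R :=
  \sum_(0 <= j < n) Phi (iter j T x).

Definition birkhoff_mean (R : realType) (T Phi : R -> R) (x : R) : R^nat :=
  fun n => n%:R^-1 * birkhoff_sum T Phi n x.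

(* The n-th variation of the symbolic version of Phi: x and y range over the
   points whose codings agree in their first n symbols. *)
Definition potential_var (R : realType) (I1 : nat -> set R) (T Phi : R -> R)
    (n : nat) : \bar R :=
  ereal_sup [set v | exists x y,
    [/\ surv I1 T x, surv I1 T y,
        forall j, (j < n)%N ->
          exists i, I1 i (iter j T x) /\ I1 i (iter j T y) &
        v = `|Phi x - Phi y|%:E]].

(* A potential is a partial function with a domain D containing I_0''. *)
Definition is_potential (R : realType) (I1 : nat -> set R) (T : R -> R)
    (D : set R) (Phi : R -> R) :=
  surv I1 T `<=` D /\ (\sum_(1 <= n <oo) potential_var I1 T Phi n < +oo)%E.

Definition partition_function (R : realType) (I1 : nat -> set R)
    (T Phi : R -> R) (n : nat) : \bar R :=
  (\esum_(x in [set x | surv I1 T x /\ iter n T x = x])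
     (expR (birkhoff_sum T Phi n x))%:E)%E.

Definition is_pressure (R : realType) (I1 : nat -> set R) (T Phi : R -> R)
    (P : R) :=
  ((n%:R^-1)%:E * lne (partition_function I1 T Phi n))%E @[n --> \oo] --> P%:E.

Definition gibbs (R : realType) (I0 : set R) (I1 : nat -> set R) (T : R -> R)
    (D : set R) (Phi : R -> R) (P : R)
    (mu : probability (measurableTypeR R) R) :=
  exists2 C : R, 1 <= C &
    forall x n y, surv I1 T x -> (1 <= n)%N -> cylinder I0 I1 T n x y ->
      (forall j, (j < n)%N -> D (iter j T y)) ->
      C^-1 <= fine (mu (cylinder I0 I1 T n x)) /
              expR (- (n%:R * P) + birkhoff_sum T Phi n y) <= C.

(* The logarithms of measures are extended-real ([lne 0 = -oo]), so that the
   dimensions take values in [\bar R]. *)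
Definition markov_ratio (R : realType) (I0 : set R) (I1 : nat -> set R)
    (T : R -> R) (mu : probability (measurableTypeR R) R) (x : R) (k : nat) :
  \bar R :=
  (lne (mu (cylinder I0 I1 T k x)) *
   ((ln (len (cylinder I0 I1 T k x)))^-1)%:E)%E.

Definition markov_dim (R : realType) (I0 : set R) (I1 : nat -> set R)
    (T : R -> R) (mu : probability (measurableTypeR R) R) (x : R) : \bar R :=
  limn (markov_ratio I0 I1 T mu x).

Definition upper_pointwise_dim (R : realType)
    (mu : probability (measurableTypeR R) R) (x : R) : \bar R :=
  limf_esup (fun r : R => (lne (mu (ball x r)) * ((ln r)^-1)%:E)%E) (0 : R)^'+.

(* Main.v *)
Require Import Defs.
From mathcomp Require Import all_boot all_order all_algebra.
From mathcomp Require Import ring lra.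
From mathcomp Require Import all_classical all_reals all_analysis.
From mathcomp Require Import measurable_realfun.
Import Order.TTheory GRing.Theory Num.Theory.
Import numFieldNormedType.Exports.
Local Open Scope classical_set_scope.
Local Open Scope ring_scope.
Set Implicit Arguments.
Unset Strict Implicit.
Unset Printing Implicit Defensive.

(* For small r choose k with |I_k| < r <= |I_(k-1)|, so that I_k is contained
   in B(x, r) and log mu(B(x, r)) / log r <= log mu(I_k) / log |I_(k-1)|.  By
   the Gibbs property, log mu(I_k) and log mu(I_(k-1)) differ by
   Phi(T^(k-1) x) + O(1), which is o(k) because the Birkhoff average exists,
   whereas - log |I_(k-1)| grows at least linearly in k by expansion.  Hence the
   right-hand side has the same limit as log mu(I_(k-1)) / log |I_(k-1)|. *)

(** * Calculus relative to an interval *)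

(** Nondegeneracy: at the only point of a singleton the filter [within A x^'] is trivial, and a
    relative derivative there carries no information. *)
Definition has_two_points (R : realType) (A : set R) :=
  exists a b, [/\ A a, A b & a != b].

Lemma has_two_points_bij (R : realType) (A B : set R) (f : R -> R) :
  set_bij A B f -> has_two_points A <-> has_two_points B.
Proof.
move=> [fAB finj fsurj]; split=> -[a [b [Ha Hb ab]]].
  exists (f a), (f b); split; [exact: fAB|exact: fAB|].
  by apply: contra_neq ab; apply: finj; rewrite inE.
have [a' Aa' fa] := fsurj _ Ha; have [b' Ab' fb] := fsurj _ Hb.
exists a', b'; split=> //; apply: contra_neq ab => ab.
by rewrite -fa -fb ab.
Qed.

Lemma near_within_dnbhs (R : realType) (A : set R) (x : R) (P : set R) :
  (\forall y \near within A x^', P y) <->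
  exists2 e : R, 0 < e & forall y, A y -> y != x -> `|x - y| < e -> P y.
Proof.
split=> [/nbhs_ballP[e /= e0 He]|[e e0 He]].
  by exists e => // y Ay yx xy; apply: He.
by apply/nbhs_ballP; exists e => //= y xy yx Ay; exact: He.
Qed.

(** Points of [A] arbitrarily close to [x] are found by a short step from [x] towards another point
    [c] of [A]; convexity keeps them in [A]. *)
Lemma within_dnbhs_proper (R : realType) (A : set R) (x : R) :
  is_interval A -> has_two_points A -> A x -> ProperFilter (within A x^').
Proof.
move=> iA [a [b [Aa Ab ab]]] Ax.
apply: Build_ProperFilter_ex => P /near_within_dnbhs[e e0 He].
have [c [Ac cx]] : exists c, A c /\ c != x.
  have [ax|ax] := eqVneq a x; last by exists a.
  by exists b; rewrite -ax eq_sym.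
have [lt_cx|le_xc] := ltP c x.
  pose d := Num.min ((x - c) / 2) (e / 2).
  have d0 : 0 < d by rewrite lt_min !divr_gt0// subr_gt0.
  have dx : d <= x - c by rewrite ge_min; apply/orP; left; lra.
  have de : d < e by rewrite gt_min; apply/orP; right; lra.
  exists (x - d); apply: He; first by apply: (iA c x) => //; lra.
  - by rewrite lt_eqF//; lra.
  - by rewrite opprB addrC subrK gtr0_norm.
have {cx}le_xc : x < c by rewrite lt_neqAle eq_sym cx.
pose d := Num.min ((c - x) / 2) (e / 2).
have d0 : 0 < d by rewrite lt_min !divr_gt0// subr_gt0.
have dx : d <= c - x by rewrite ge_min; apply/orP; left; lra.
have de : d < e by rewrite gt_min; apply/orP; right; lra.
exists (x + d); apply: He; first by apply: (iA x c) => //; lra.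
- by rewrite gt_eqF//; lra.
- by rewrite distrC addrC addKr gtr0_norm.
Qed.

Lemma derive_within_cvg (R : realType) (A : set R) (f : R -> R) (x : R) :
  derivable_within A f x ->
  slope f x y @[y --> within A x^'] --> derive_within A f x.
Proof. by []. Qed.

Lemma derive_withinE (R : realType) (A : set R) (f : R -> R) (x l : R) :
  is_interval A -> has_two_points A -> A x ->
  slope f x y @[y --> within A x^'] --> l -> derive_within A f x = l.
Proof.
move=> iA nA Ax; have := within_dnbhs_proper iA nA Ax => pF.
exact: cvg_lim.
Qed.

(** For [y != x] one has [f y = f x + slope f x y * (y - x)]; the slope converges and [y - x] tends
    to 0. *)
Lemma derivable_within_cvg_dnbhs (R : realType) (A : set R) (f : R -> R)
    (x : R) :
  derivable_within A f x -> f y @[y --> within A x^'] --> f x.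
Proof.
move=> /derive_within_cvg df.
have H : f x + slope f x y * (y - x) @[y --> within A x^'] -->
    f x + derive_within A f x * (x - x).
  apply: cvgD; first exact: cvg_cst.
  apply: cvgM => //; apply: cvgB; last exact: cvg_cst.
  by apply: cvg_within_filter; exact: cvg_within.
rewrite subrr mulr0 addr0 in H.
apply: cvg_trans H; apply: near_eq_cvg.
apply/near_within_dnbhs; exists 1 => // y _ yx _.
by rewrite /slope divfK ?subr_eq0// addrC subrK.
Qed.

Lemma within_nbhs_dnbhs (R : realType) (A : set R) (x : R) (P : set R) :
  within A (nbhs x) P <-> within A x^' P /\ (A x -> P x).
Proof.
split=> [H|[/near_within_dnbhs[e e0 He] Px]].
  split; last by have := nbhs_singleton H.
  by apply: (@filterS _ (nbhs x) _ _ _ _ H) => y /= H1 _.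
apply/nbhs_ballP; exists e => //= y xy Ay.
by case: (eqVneq y x) Ay => [->|yx] Ay; [exact: Px|exact: He].
Qed.

Lemma derivable_within_cvg_nbhs (R : realType) (A : set R) (f : R -> R)
    (x : R) :
  derivable_within A f x -> f y @[y --> within A (nbhs x)] --> f x.
Proof.
move=> /derivable_within_cvg_dnbhs df P nP; apply/within_nbhs_dnbhs.
by split; [exact: df|move=> _; exact: nbhs_singleton nP].
Qed.

Lemma C1_on_continuous (R : realType) (A : set R) (f : R -> R) :
  C1_on A f -> {within A, continuous f}.
Proof.
move=> [df _]; apply/subspace_continuousP => x Ax.
exact: derivable_within_cvg_nbhs (df _ Ax).
Qed.

Lemma cvg_within_eq (R : realType) (A : set R) (f g : R -> R) (x l : R) :
  (forall y, A y -> f y = g y) -> f y @[y --> within A (nbhs x)] --> l ->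
  g y @[y --> within A (nbhs x)] --> l.
Proof.
move=> fg; apply: cvg_trans; apply: near_eq_cvg.
apply/within_nbhs_dnbhs; split; last exact: fg.
by apply/near_within_dnbhs; exists 1 => // y /fg.
Qed.

Lemma within_dnbhs_sub (R : realType) (A B : set R) (x : R) :
  A `<=` B -> within A x^' --> within B x^'.
Proof. by move=> AB P /= H; apply: (@filterS _ x^' _ _ _ _ H) => y /= H1 /AB. Qed.

Lemma within_nbhs_sub (R : realType) (A B : set R) (x : R) :
  A `<=` B -> within A (nbhs x) --> within B (nbhs x).
Proof. by move=> AB P /= H; apply: (@filterS _ (nbhs x) _ _ _ _ H) => y /= H1 /AB. Qed.

(** The filter [within A x^'] is at least as fine as [within B x^'] and is still proper, so by
    uniqueness of limits both relative derivatives agree on [A]. *)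
Lemma C1_on_sub (R : realType) (A B : set R) (f : R -> R) :
  is_interval A -> has_two_points A -> A `<=` B -> C1_on B f -> C1_on A f.
Proof.
move=> iA nA AB [df cf].
have dcv x : A x -> slope f x y @[y --> within A x^'] --> derive_within B f x.
  move=> Ax; have := derive_within_cvg (df x (AB _ Ax)).
  by apply: cvg_trans; apply: cvg_app; exact: within_dnbhs_sub.
have dE x : A x -> derive_within A f x = derive_within B f x.
  by move=> Ax; apply: derive_withinE => //; exact: dcv.
split=> [x Ax|]; first by apply/cvg_ex; exists (derive_within B f x); exact: dcv.
apply/subspace_continuousP => x Ax; rewrite /from_subspace dE//.
have /subspace_continuousP/(_ x (AB _ Ax)) := cf.
move=> H; have {}H : derive_within B f y @[y --> within A (nbhs x)]
    --> derive_within B f x.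
  by apply: cvg_trans H; apply: cvg_app; exact: within_nbhs_sub.
by apply: cvg_within_eq H => y Ay; exact/esym/dE.
Qed.

(** Chain rule. Injectivity of [f] gives [f y != f x] for [y != x], so the slope of [h \o f] is a
    product of two slopes with nonzero denominators. *)
Lemma C1_on_comp (R : realType) (A B : set R) (f h : R -> R) :
  is_interval A -> has_two_points A -> set_fun A B f -> set_inj A f ->
  C1_on A f -> C1_on B h -> C1_on A (h \o f).
Proof.
move=> iA nA fAB finj [df cf] [dh ch].
have fcvg x : A x -> f y @[y --> within A x^'] --> within B (f x)^'.
  move=> Ax P /near_within_dnbhs[e e0 He].
  have /derivable_within_cvg_dnbhs/cvgrPdist_lt/(_ e e0) := df x Ax.
  move=> /near_within_dnbhs[d d0 Hd]; apply/near_within_dnbhs.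
  exists d => // y Ay yx xy; apply: He; [exact: fAB| |exact: Hd].
  by apply: contra_neq yx; apply: finj; rewrite inE.
have fcvg' x : A x -> f y @[y --> within A (nbhs x)] --> within B (nbhs (f x)).
  move=> Ax P /within_nbhs_dnbhs[P1 P2]; apply/within_nbhs_dnbhs; split.
    exact: fcvg P1.
  by move=> _; apply: P2; exact: fAB.
have dcv x : A x -> slope (h \o f) x y @[y --> within A x^'] -->
    derive_within B h (f x) * derive_within A f x.
  move=> Ax.
  have H : slope h (f x) (f y) * slope f x y @[y --> within A x^'] -->
      derive_within B h (f x) * derive_within A f x.
    apply: cvgM; last exact: (derive_within_cvg (df _ Ax)).
    exact: cvg_comp (fcvg _ Ax) (derive_within_cvg (dh _ (fAB _ Ax))).
  apply: cvg_trans H; apply: near_eq_cvg.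
  apply/near_within_dnbhs; exists 1 => // y Ay yx _.
  rewrite /slope /= mulrA divfK// subr_eq0.
  by apply: contra_neq yx; apply: finj; rewrite inE.
have dE x : A x -> derive_within A (h \o f) x =
    derive_within B h (f x) * derive_within A f x.
  by move=> Ax; apply: derive_withinE => //; exact: dcv.
split=> [x Ax|].
  by apply/cvg_ex; eexists; exact: dcv.
apply/subspace_continuousP => x Ax; rewrite /from_subspace dE//.
have H : derive_within B h (f y) * derive_within A f y
    @[y --> within A (nbhs x)] --> derive_within B h (f x) * derive_within A f x.
  apply: cvgM; last by move/subspace_continuousP: cf; exact.
  apply: cvg_comp (fcvg' _ Ax) _.
  by move/subspace_continuousP: ch; apply; exact: fAB.
by apply: cvg_within_eq H => y Ay; exact/esym/dE.
Qed.

(** * Mean value theorem and expansion of distances *)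

(** Since [c] lies strictly between two points of the interval [A], a full neighbourhood of [c] lies
    in [A], and the relative derivative is the ordinary one. *)
Lemma is_derive_within (R : realType) (A : set R) (f : R -> R) (y z c : R) :
  is_interval A -> A y -> A z -> y < c < z -> derivable_within A f c ->
  is_derive c 1 f (derive_within A f c).
Proof.
move=> iA Ay Az /andP[yc cz] /derive_within_cvg df.
have H : h^-1 *: ((f \o shift c) (h *: 1) - f c) @[h --> 0^'] -->
    derive_within A f c.
  apply/cvgrPdist_lt => e e0.
  have /cvgrPdist_lt/(_ e e0)/near_within_dnbhs[d d0 Hd] := df.
  have m0 : 0 < Num.min d (Num.min (c - y) (z - c)).
    by rewrite !lt_min d0 !subr_gt0 yc cz.
  apply/nbhs_ballP; exists (Num.min d (Num.min (c - y) (z - c))) => // h.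
  have -> : ball (0 : R) (Num.min d (Num.min (c - y) (z - c))) h =
      (`|0 - h| < Num.min d (Num.min (c - y) (z - c))) by [].
  rewrite sub0r normrN !lt_min => /and3P[hd hy hz] h0.
  have := Hd (h + c); rewrite /slope addrK mulrC /= /GRing.scale /= mulr1.
  apply.
  - move: hy hz; rewrite !ltr_norml => /andP[? ?] /andP[? ?].
    by apply: (iA y z) => //; lra.
  - by rewrite -subr_eq0 addrK.
  - by rewrite distrC addrK.
have D : derivable f c 1 by apply/cvg_ex; eexists; exact: H.
apply: DeriveDef => //.
exact: cvg_lim H.
Qed.

(** Mean value theorem between [y] and [z]: it asks for ordinary derivatives only strictly inside,
    so one-sided derivatives at endpoints of [A] do no harm. *)
Lemma expanding_dist (R : realType) (A : set R) (f : R -> R) (lam y z : R) :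
  is_interval A -> C1_on A f ->
  (forall x, A x -> lam <= `|derive_within A f x|) ->
  A y -> A z -> lam * `|y - z| <= `|f y - f z|.
Proof.
move=> iA cf lamle.
wlog yz : y z / y <= z => [hw Ay Az|Ay Az].
  case/orP: (le_total y z) => yz; first exact: hw.
  by rewrite distrC [leRHS]distrC; exact: hw.
move: yz; rewrite le_eqVlt => /predU1P[->|yz]; first by rewrite !subrr normr0 mulr0.
rewrite distrC [leRHS]distrC.
have [c||c cyz ->] := @MVT R f (derive_within A f) y z yz.
- rewrite in_itv => /= ycz; apply: (is_derive_within iA Ay Az) => //.
  by apply: cf.1; case/andP: ycz => ? ?; apply: (iA y z) => //; rewrite !ltW.
- by apply: continuous_subspaceW (C1_on_continuous cf) => t /=;
    rewrite in_itv /=; exact: iA.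
rewrite normrM; apply: ler_wpM2r => //; apply: lamle.
by move: cyz; rewrite in_itv /= => /andP[? ?]; apply: (iA y z) => //; rewrite !ltW.
Qed.

Lemma EMR_dist (R : realType) (I0 : set R) (I1 : nat -> set R) (T : R -> R) :
  EMR I0 I1 T -> exists2 lam : R, 1 < lam &
    forall i y z, I1 i y -> I1 i z -> lam * `|y - z| <= `|T y - T z|.
Proof.
(* The constant is the infimum of [|DT|] over all branches. *)
move=> emr; eexists; first exact: EMR_expanding emr.
move=> i y z; apply: expanding_dist; first exact: EMR_itv1 emr _.
  by have [] := EMR_diffeo emr i.
move=> x ix; apply: ge_inf; last by exists i, x.
by exists 0 => _ [j [w [_ ->]]].
Qed.

(** * Existence of cylinders *)

(** The branches with indices 0 and 1 both map onto [I0], so [x] has a preimage in each, and these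
    differ because the branches are disjoint. *)
Lemma EMR_two_points (R : realType) (I0 : set R) (I1 : nat -> set R)
    (T : R -> R) (x : R) :
  EMR I0 I1 T -> I0 x -> has_two_points I0.
Proof.
move=> emr I0x.
have [[_ _ s0] _ _] := EMR_diffeo emr 0%N.
have [[_ _ s1] _ _] := EMR_diffeo emr 1%N.
have [a a0 _] := s0 _ I0x; have [b b1 _] := s1 _ I0x.
exists a, b; split; [exact: EMR_sub1 emr _ _ a0|exact: EMR_sub1 emr _ _ b1|].
apply/eqP => ab; rewrite -{b}ab in b1.
have // : 0%N = 1%N by apply: (EMR_disj emr) => //; exists a.
Qed.

(** [T^n] already maps [J] onto [I0] and is injective on [J'], so [J'] has no room for further
    points. Every branch is therefore a cylinder. *)
Lemma branch_maximal (R : realType) (I0 : set R) (I1 : nat -> set R)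
    (T : R -> R) (n : nat) (x x' : R) (J J' : set R) :
  branch I0 I1 T n x J -> branch I0 I1 T n x' J' -> J `<=` J' -> J' = J.
Proof.
move=> [_ _ _ [[_ _ surj] _ _]] [_ _ _ [[fJ' inj _] _ _]] JJ'.
apply/seteqP; split=> // y J'y.
have [z Jz zy] := surj _ (fJ' _ J'y).
suff <- : z = y by [].
by apply: inj => //; rewrite inE//; exact: JJ'.
Qed.

Lemma image_is_interval (R : realType) (A : set R) (f : R -> R) :
  is_interval A -> {within A, continuous f} -> is_interval (f @` A).
Proof.
move=> /connected_intervalP cA cf.
by apply/connected_intervalP; exact: connected_continuous_connected.
Qed.

Lemma C1_on_image_is_interval (R : realType) (A B : set R) (f : R -> R) :
  is_interval A -> A `<=` B -> C1_on B f -> is_interval (f @` A).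
Proof.
move=> iA AB /C1_on_continuous cf; apply: image_is_interval => //.
exact: continuous_subspaceW cf.
Qed.

(** Induction on [n]: a branch [J'] at [T x] is pulled back by the inverse [g] of the branch of [T]
    containing [x]. *)
Lemma branch_exists (R : realType) (I0 : set R) (I1 : nat -> set R)
    (T : R -> R) (n : nat) (x : R) :
  EMR I0 I1 T -> domn I1 T n.+1 x -> exists J, branch I0 I1 T n.+1 x J.
Proof.
move=> emr; elim: n x => [|n IHn] x dx.
  have [i _ xi] := dx 0%N isT; exists (I1 i); split => //.
  - exact: EMR_itv1 emr i.
  - by move=> y yi [|//] _; exists i.
  - exact: EMR_diffeo emr i.
have [i _ xi] := dx 0%N isT.
have [|J' [iJ' J'Tx J'dom dJ']] := IHn (T x).
  by move=> j jn; rewrite -iterSr; exact: dx.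
have [[TI Tinj Tsurj] TC1 [g [gK gC1]]] := EMR_diffeo emr i.
have [bijJ' C1J' [G [GK GC1]]] := dJ'.
have [fJ' injJ' surjJ'] := bijJ'.
have J'I0 : J' `<=` I0.
  by move=> u /J'dom/(_ 0%N isT)[k _]; exact: EMR_sub1 emr k u.
have n0 : has_two_points I0 := EMR_two_points emr (TI _ xi).
have nJ' : has_two_points J' by apply/(has_two_points_bij bijJ').
have gI u : I0 u -> I1 i (g u) /\ T (g u) = u.
  by move=> /Tsurj[w wi <-]; rewrite gK.
pose J := g @` J'.
have JI : J `<=` I1 i by move=> _ [u /J'I0/gI[] ? _ <-].
have TJ : set_bij J J' T.
  split=> [_ [u J'u <-]|a b|u J'u].
  - by have [_ ->] := gI _ (J'I0 _ J'u).
  - rewrite !inE => /JI aI /JI bI; apply: Tinj; by rewrite inE.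
  - exists (g u); first by exists u.
    by have [_ ->] := gI _ (J'I0 _ J'u).
have nJ : has_two_points J by apply/(has_two_points_bij TJ).
have iJ : is_interval J by apply: C1_on_image_is_interval gC1.
have TnE : iter n.+2 T = iter n.+1 T \o T by apply/funext => y; rewrite iterSr.
exists J; split=> //.
- by exists (T x) => //; rewrite gK.
- move=> y Jy [_|j jn]; first by exists i => //; exact: JI.
  by rewrite iterSr; apply: J'dom => //; case: TJ => + _ _; apply.
have GJ' u : I0 u -> J' (G u) by move=> /surjJ'[w J'w <-]; rewrite GK.
split.
- by rewrite TnE; exact: set_bij_comp TJ bijJ'.
- rewrite TnE; apply: (C1_on_comp (B := J')) => //; [by case: TJ|by case: TJ|].
  exact: C1_on_sub TC1.
(* The inverse undoes the last [n.+1] iterates by [G], then the first one by [g]. *)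
- exists (g \o G); split=> [y Jy|].
    rewrite TnE /= GK; last by case: TJ => + _ _; apply.
    by rewrite gK//; exact: JI.
  apply: (C1_on_comp (B := I0)) => //; first exact: EMR_itv0 emr.
    by move=> u /GJ'/J'I0.
  move=> a b; rewrite !inE => /surjJ'[a' J'a <-] /surjJ'[b' J'b <-].
  by rewrite !GK// => ->.
Qed.

Lemma surv_domn (R : realType) (I1 : nat -> set R) (T : R -> R) (n : nat)
    (x : R) : surv I1 T x -> domn I1 T n x.
Proof. by move=> [x0 xn] [|j] _ //; exact: xn. Qed.

(** Ensures that [xget] does not return its default [set0]: a branch exists and is maximal. *)
Lemma cylinder_branch (R : realType) (I0 : set R) (I1 : nat -> set R)
    (T : R -> R) (n : nat) (x : R) :
  EMR I0 I1 T -> surv I1 T x -> branch I0 I1 T n.+1 x (cylinder I0 I1 T n.+1 x).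
Proof.
move=> emr sx; have [J bJ] := branch_exists emr (surv_domn (n := n.+1) sx).
suff [] : is_cylinder I0 I1 T n.+1 x (cylinder I0 I1 T n.+1 x) by [].
apply: xgetPex; exists J; split=> // J' bJ'; exact: branch_maximal bJ bJ'.
Qed.


(** * Expansion of Lebesgue measure *)

Lemma itv_measure_ge (R : realType) (E : set R) (a b : R) :
  is_interval E -> E a -> E b -> ((b - a)%:E <= lebesgue_measure E)%E.
Proof.
move=> iE Ea Eb; have [ab|ba] := ltP a b; last first.
  by apply: (@le_trans _ _ 0%E) => //; rewrite lee_fin subr_le0.
have <- : lebesgue_measure `[a, b]%classic = (b - a)%:E.
  by rewrite lebesgue_measure_itv /= lte_fin ab.
apply: le_measure; rewrite ?inE; [exact: measurable_itv| |].
  exact: is_interval_measurable.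
by move=> t /=; rewrite in_itv /=; exact: iE.
Qed.

(** A nonempty [E] of diameter at most [M] lies in [[sup E - M, sup E]]. *)
Lemma itv_measure_le (R : realType) (E : set R) (M : R) :
  is_interval E -> 0 <= M -> (forall a b, E a -> E b -> b - a <= M) ->
  (lebesgue_measure E <= M%:E)%E.
Proof.
move=> iE M0 EM; have [->|/set0P[c Ec]] := eqVneq E set0.
  by rewrite measure0 lee_fin.
have ubE : has_ubound E by exists (c + M) => a Ea; rewrite -lerBlDl; exact: EM.
have <- : (lebesgue_measure `[(sup E - M)%R, sup E]%classic = M%:E)%E.
  rewrite lebesgue_measure_itv /= lte_fin ltrBlDr ltrDl -EFinB subKr.
  by case: ltP => // M0'; congr EFin; apply/eqP; rewrite eq_le M0 M0'.
apply: le_measure; rewrite ?inE; [exact: is_interval_measurable|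
  exact: measurable_itv|] => a Ea /=; rewrite in_itv /=; apply/andP; split.
  rewrite lerBlDr; apply: ge_sup; first by exists c.
  by move=> b Eb; rewrite -lerBlDl; exact: EM.
exact: ub_le_sup.
Qed.

Lemma expanding_measure (R : realType) (E : set R) (f : R -> R) (lam : R) :
  is_interval E -> is_interval (f @` E) -> 0 < lam ->
  (forall y z, E y -> E z -> lam * `|y - z| <= `|f y - f z|) ->
  (lam%:E * lebesgue_measure E <= lebesgue_measure (f @` E))%E.
Proof.
move=> iE ifE lam0 fexp.
have [->|fin] := eqVneq (lebesgue_measure (f @` E)) +oo%E; first exact: leey.
have {}fin : lebesgue_measure (f @` E) \is a fin_num by rewrite ge0_fin_numE// ltey.
rewrite -(fineK fin) -lee_pdivlMl// -EFinM.
apply: itv_measure_le => //.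
  by rewrite mulr_ge0 ?invr_ge0 ?(ltW lam0)// fine_ge0.
move=> a b Ea Eb; rewrite ler_pdivlMl//.
apply: (@le_trans _ _ `|f b - f a|).
  by apply: le_trans (fexp _ _ Eb Ea); rewrite ler_pM2l// ler_norm.
rewrite -lee_fin fineK//.
have fEa : (f @` E) (f a) by exists a.
have fEb : (f @` E) (f b) by exists b.
by case: (ger0P (f b - f a)) => _; rewrite ?opprB; exact: itv_measure_ge.
Qed.

(* The set E may a priori meet several of the intervals I1 i, between which T
   can jump; summing over these pieces avoids showing that it meets only one. *)
Lemma iter_expanding_measure (R : realType) (I1 : nat -> set R) (T : R -> R)
    (lam : R) :
  (forall i, is_interval (I1 i)) -> trivIset setT I1 ->
  (forall i, {within I1 i, continuous T}) -> 0 < lam ->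
  (forall i y z, I1 i y -> I1 i z -> lam * `|y - z| <= `|T y - T z|) ->
  forall n (E : set R), is_interval E -> E `<=` domn I1 T n ->
    set_inj E (iter n T) ->
    measurable (iter n T @` E) /\
    ((lam ^+ n)%:E * lebesgue_measure E <= lebesgue_measure (iter n T @` E))%E.
Proof.
move=> iI1 disj cT lam0 Texp; elim=> [|n IHn] E iE Edom Einj.
  by rewrite image_id expr0 mul1e; split=> //; exact: is_interval_measurable.
pose Ei i := E `&` I1 i.
have iEi i : is_interval (Ei i).
  move=> a b [Ea ia] [Eb ib] c acb; split; [exact: iE acb|exact: iI1 acb].
have Ecup : E = \bigcup_i Ei i.
  rewrite -setI_bigcupr; apply/seteqP; split=> [y Ey|y []//]; split=> //.
  exact: (Edom y Ey 0%N isT).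
have Etriv : trivIset setT Ei by exact: trivIset_setIl.
have iTEi i : is_interval (T @` Ei i).
  apply: image_is_interval => //; apply: continuous_subspaceW (cT i).
  by move=> y [].
have imE i : iter n.+1 T @` Ei i = iter n T @` (T @` Ei i).
  by rewrite image_comp; apply: eq_imagel => y _; rewrite iterSr.
have {}IHn i := IHn (T @` Ei i) (iTEi i).
have {}IHn i : measurable (iter n.+1 T @` Ei i) /\
    ((lam ^+ n.+1)%:E * lebesgue_measure (Ei i) <=
     lebesgue_measure (iter n.+1 T @` Ei i))%E.
  rewrite imE; have [||mi le_i] := IHn i.
  - by move=> _ [y [Ey _] <-] j jn; rewrite -iterSr; exact: Edom.
  - move=> u v /set_mem[y [Ey _] <-] /set_mem[z [Ez _] <-].
    by rewrite -!iterSr => /Einj -> //; rewrite inE.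
  split=> //; apply: le_trans le_i.
  rewrite exprSr EFinM -muleA; apply: lee_wpmul2l.
    by rewrite lee_fin exprn_ge0// ltW.
  by apply: expanding_measure => // y z [_ yi] [_ zi]; exact: Texp yi zi.
(* Injectivity of the iterate on [E] keeps the images of the pieces disjoint, so their measures add
   up. *)
have tr : trivIset setT (fun i => iter n.+1 T @` Ei i).
  move=> i j _ _ [_ [[y [Ey yi] <-] [z [Ez zj] /Einj yz]]].
  have {}yz : z = y by apply: yz; rewrite inE.
  by apply: disj => //; exists y; split=> //; rewrite -yz.
have -> : iter n.+1 T @` E = \bigcup_i (iter n.+1 T @` Ei i).
  by rewrite {1}Ecup image_bigcup.
split.
  by apply: bigcup_measurable => i _; have [] := IHn i.
rewrite [X in lebesgue_measure X]Ecup !measure_bigcup//; first last.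
- by move=> i _; exact: is_interval_measurable.
- by move=> i _; have [] := IHn i.
rewrite -nneseriesZl//; apply: lee_nneseries => i _.
  by move=> _; rewrite mule_ge0// lee_fin exprn_ge0// ltW.
by have [] := IHn i.
Qed.

(** * Sublinear growth along an orbit *)

Lemma birkhoff_sumS (R : realType) (T Phi : R -> R) (n : nat) (x : R) :
  birkhoff_sum T Phi n.+1 x = birkhoff_sum T Phi n x + Phi (iter n T x).
Proof. by rewrite /birkhoff_sum big_nat_recr. Qed.

(** With [M_n] the Birkhoff means, [Phi (T^n x) / (n+1) = M_(n+1) - M_n + M_n / (n+1)], which tends
    to 0 when the means converge. *)
Lemma birkhoff_term_sublinear (R : realType) (T Phi : R -> R) (x e : R) :
  cvgn (birkhoff_mean T Phi x) -> 0 < e ->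
  \forall n \near \oo, `|Phi (iter n T x)| <= e * n%:R.
Proof.
move=> cvb e0; set l := limn (birkhoff_mean T Phi x).
have termE n : n.+1%:R^-1 * Phi (iter n T x) = birkhoff_mean T Phi x n.+1 -
    (birkhoff_mean T Phi x n - n.+1%:R^-1 * birkhoff_mean T Phi x n).
  rewrite /birkhoff_mean birkhoff_sumS.
  have n1 : n.+1%:R != 0 :> R by rewrite pnatr_eq0.
  (* At [n = 0] the mean is [0^-1 * 0 = 0] by convention; the field identity needs a nonzero
     denominator. *)
  case: n n1 => [|n] n1.
    by rewrite /birkhoff_sum big_geq// !mulr0 add0r !subr0.
  have n0 : n.+1%:R != 0 :> R by rewrite pnatr_eq0.
  rewrite -[n.+2%:R]natr1 in n1 *; move: (n.+1%:R : R) n0 n1 => a n0 n1.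
  by field; rewrite n0 n1.
have H : n.+1%:R^-1 * Phi (iter n T x) @[n --> \oo] --> l - (l - 0 * l).
  have -> : (fun n => n.+1%:R^-1 * Phi (iter n T x)) = (fun n =>
      birkhoff_mean T Phi x n.+1 -
      (birkhoff_mean T Phi x n - n.+1%:R^-1 * birkhoff_mean T Phi x n)).
    by apply/funext => n; exact: termE.
  apply: cvgB; first by rewrite (cvg_shiftS (birkhoff_mean T Phi x)).
  apply: cvgB => //; apply: cvgM => //; exact: cvg_harmonic.
rewrite mul0r subr0 subrr in H.
(* Half of [e] suffices because [n + 1 <= 2 * n] for [n >= 1]. *)
have e20 : 0 < e / 2 by rewrite divr_gt0.
have /cvgrPdist_le/(_ _ e20) := H.
apply: filterS2 (nbhs_infty_gt 0) => n n0.
rewrite sub0r normrN normrM ger0_norm ?invr_ge0// ler_pdivrMl ?ltr0n//.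
move/le_trans; apply; rewrite -natr1.
have : 1 <= n%:R :> R by rewrite ler1n.
by move: e0; nra.
Qed.

(** * Lengths of cylinders *)

(** [T^n] expands measure by at least [lam ^+ n] on [J], and its image [I0] lies in [[0, 1]]. *)
Lemma branch_measure_le (R : realType) (I0 : set R) (I1 : nat -> set R)
    (T : R -> R) (lam : R) (n : nat) (x : R) (J : set R) :
  EMR I0 I1 T -> 0 < lam ->
  (forall i y z, I1 i y -> I1 i z -> lam * `|y - z| <= `|T y - T z|) ->
  branch I0 I1 T n x J -> (lebesgue_measure J <= (lam ^- n)%:E)%E.
Proof.
move=> emr lam0 Texp [iJ Jx Jdom [[fJ inj surj] _ _]].
have imJ : iter n T @` J = I0.
  by apply/seteqP; split=> [_ [y Jy <-]|y /surj//]; exact: fJ.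
have [|_] := iter_expanding_measure (EMR_itv1 emr) (EMR_disj emr) _ lam0 Texp
  iJ Jdom inj.
  by move=> i; apply: C1_on_continuous; have [] := EMR_diffeo emr i.
rewrite imJ => le_I0; rewrite -[X in (_ <= X)%E]mule1.
rewrite lee_pdivlMl ?exprn_gt0//; apply: (le_trans le_I0).
apply: itv_measure_le => //; first exact: EMR_itv0 emr.
move=> a b /(EMR_sub0 emr) + /(EMR_sub0 emr).
by rewrite /= !in_itv /= => /andP[? ?] /andP[? ?]; lra.
Qed.

(** The measure is finite, so [fine] in [len] loses nothing. The length is positive because [J]
    contains preimages of two distinct points of [I0]. *)
Lemma branch_len_dist (R : realType) (I0 : set R) (I1 : nat -> set R)
    (T : R -> R) (n : nat) (x : R) (J : set R) :
  EMR I0 I1 T -> branch I0 I1 T n x J ->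
  (forall y z, J y -> J z -> `|y - z| <= len J) /\ 0 < len J.
Proof.
move=> emr bJ; have [iJ Jx Jdom [bij _ _]] := bJ.
have [lam lam1 Texp] := EMR_dist emr.
have := branch_measure_le emr (lt_trans ltr01 lam1) Texp bJ => leJ.
have fin : lebesgue_measure J \is a fin_num.
  by rewrite ge0_fin_numE//; apply: le_lt_trans leJ _; rewrite ltry.
have lenE : (len J)%:E = lebesgue_measure J by rewrite /len fineK.
have lenJ y z : J y -> J z -> `|y - z| <= len J.
  move=> Jy Jz; rewrite -lee_fin lenE.
  by case: ger0P => _; rewrite ?opprB; exact: itv_measure_ge.
split=> //; case: bij => fJ _ surj.
have [a [b [I0a I0b ab]]] := EMR_two_points emr (fJ _ Jx).
have [a' Ja fa] := surj _ I0a; have [b' Jb fb] := surj _ I0b.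
apply: lt_le_trans (lenJ _ _ Ja Jb).
rewrite normr_gt0 subr_eq0; apply: contra_neq ab => ab.
by rewrite -fa -fb ab.
Qed.

(** * Measures of consecutive cylinders *)

(** Dividing the Gibbs bounds at two consecutive levels cancels all of the Birkhoff sum but its last
    term. *)
Lemma gibbs_cylinder (R : realType) (I0 : set R) (I1 : nat -> set R)
    (T Phi : R -> R) (D : set R) (P : R)
    (mu : probability (measurableTypeR R) R) (x : R) :
  EMR I0 I1 T -> surv I1 T `<=` D -> gibbs I0 I1 T D Phi P mu -> surv I1 T x ->
  (forall n, 0 < fine (mu (cylinder I0 I1 T n.+1 x))) /\
  exists B : R, forall n, - ln (fine (mu (cylinder I0 I1 T n.+2 x))) <=
    - ln (fine (mu (cylinder I0 I1 T n.+1 x))) +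
    (B + `|Phi (iter n.+1 T x)|).
Proof.
move=> emr survD [C C1 gb] sx.
have C0 : 0 < C by exact: lt_le_trans C1.
have {}gb n : C^-1 * expR (- (n.+1%:R * P) + birkhoff_sum T Phi n.+1 x) <=
    fine (mu (cylinder I0 I1 T n.+1 x)) <=
    C * expR (- (n.+1%:R * P) + birkhoff_sum T Phi n.+1 x).
  have /andP[g1 g2] : C^-1 <= fine (mu (cylinder I0 I1 T n.+1 x)) /
      expR (- (n.+1%:R * P) + birkhoff_sum T Phi n.+1 x) <= C; last first.
    by rewrite -ler_pdivlMr ?expR_gt0// g1 /= -ler_pdivrMr ?expR_gt0.
  (* The Gibbs bound is taken at [y = x], whose orbit stays in [surv I1 T] and hence in [D]. *)
  apply: gb => //; first by have [] := cylinder_branch n emr sx.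
  move=> j _; apply: survD; split.
    by case: j => [|j]; [exact: sx.1|exact: sx.2].
  by move=> k k1; rewrite -iterD; apply: sx.2; rewrite addn_gt0 k1.
have q0 n : 0 < fine (mu (cylinder I0 I1 T n.+1 x)).
  have /andP[+ _] := gb n; apply: lt_le_trans.
  by rewrite mulr_gt0 ?invr_gt0// expR_gt0.
(* Each of the two Gibbs bounds costs [ln C]; the terms in [P] differ by one [P]. *)
split=> //; exists (ln C *+ 2 + `|P|) => n.
have lnle (a b : R) : 0 < a -> a <= b -> ln a <= ln b.
  by move=> a0 ab; rewrite ler_ln ?posrE// (lt_le_trans a0).
have /andP[_ /(lnle _ _ (q0 n))] := gb n.
have /andP[/lnle + _] := gb n.+1.
rewrite mulr_gt0 ?invr_gt0 ?expR_gt0// => /(_ isT).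
rewrite !lnM ?posrE ?invr_gt0 ?expR_gt0// lnV ?posrE// !expRK.
rewrite [birkhoff_sum _ _ n.+2 _]birkhoff_sumS -[in n.+2%:R]natr1.
have := ler_norm P; have := ler_norm (- Phi (iter n.+1 T x)).
by rewrite normrN; lra.
Qed.

(** * Comparison of balls with cylinders *)

Theorem lemmaC1 (R : realType) (I0 : set R) (I1 : nat -> set R) (T : R -> R)
    (D : set R) (Phi : R -> R) (P : R)
    (mu : probability (measurableTypeR R) R) (x : R)
    (T_emr : EMR I0 I1 T)
    (Phi_pot : is_potential I1 T D Phi)
    (P_pressure : is_pressure I1 T Phi P)
    (mu_I : mu [set y : R | 0 <= y <= 1] = 1%E)
    (mu_gibbs : gibbs I0 I1 T D Phi P mu)
    (x_surv : surv I1 T x)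
    (markov_dim_exists : cvgn (markov_ratio I0 I1 T mu x))
    (birkhoff_exists : cvgn (birkhoff_mean T Phi x)) :
  (upper_pointwise_dim mu x <= markov_dim I0 I1 T mu x)%E.
Proof.
have [lam lam1 Texp] := EMR_dist T_emr.
have lam0 : 0 < lam := lt_trans ltr01 lam1.
have [q0 [B stepB]] := gibbs_cylinder T_emr Phi_pot.1 mu_gibbs x_surv.
pose J n := cylinder I0 I1 T n x.
pose q n := fine (mu (J n)).
pose L n := - ln (len (J n)).
have bJ n : branch I0 I1 T n.+1 x (J n.+1) := cylinder_branch n T_emr x_surv.
have lenJ n y z : J n.+1 y -> J n.+1 z -> `|y - z| <= len (J n.+1).
  exact: (branch_len_dist T_emr (bJ n)).1.
have len0 n : 0 < len (J n.+1) := (branch_len_dist T_emr (bJ n)).2.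
have len_le n : len (J n.+1) <= lam ^- n.+1.
  have := branch_measure_le T_emr lam0 Texp (bJ n).
  move=> leJ; rewrite -lee_fin /len fineK// ge0_fin_numE//.
  by apply: le_lt_trans leJ _; rewrite ltry.
have lnlam : 0 < ln lam by exact: ln_gt0.
have L_ge n : n.+1%:R * ln lam <= L n.+1.
  rewrite /L lerNr mulr_natl -lnXn// -lnV ?posrE ?exprn_gt0//.
  by rewrite ler_ln ?posrE ?invr_gt0 ?exprn_gt0.
have L0 n : 0 < L n.+1.
  by apply: lt_le_trans (L_ge n); rewrite mulr_gt0// ltr0n.
have measJ n : measurable (J n.+1 : set (measurableTypeR R)).
  by apply: is_interval_measurable; have [] := bJ n.
have muJ n : mu (J n.+1) = (q n.+1)%:E.
  by rewrite /q fineK//; apply: fin_num_measure; exact: measJ.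
have m0 n : 0 <= - ln (q n.+1).
  by rewrite oppr_ge0 ln_le0// -lee_fin -muJ probability_le1.
have ratioE n : markov_ratio I0 I1 T mu x n.+1 = (- ln (q n.+1) / L n.+1)%:E.
  rewrite /markov_ratio muJ lne_EFin; last exact: q0.
  by rewrite -EFinM /L invrN mulrNN.
have ratio_cvg := markov_dim_exists.
rewrite /markov_dim; move: ratio_cvg.
have : (0 <= limn (markov_ratio I0 I1 T mu x))%E.
  apply: lime_ge => //; apply: filterS (nbhs_infty_gt 0) => -[//|n] _.
  by rewrite ratioE lee_fin divr_ge0// ltW//; exact: L0.
(* The limit is nonnegative, so [-oo] is excluded; [+oo] is trivial, and a real [d] remains. *)
case: (limn (markov_ratio I0 I1 T mu x)) => [d||] //; last by move=> _ _; exact: leey.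
move=> _ /fine_cvgP[_ /cvgrPdist_lt ratio_cvg].
apply/lee_addgt0Pr => e e0.
have e20 : 0 < e / 2 by rewrite divr_gt0.
have e40 : 0 < e / 4 * ln lam by rewrite mulr_gt0// divr_gt0.
(* The slack [e] is halved between the Markov ratio and the Gibbs step. In the latter, [B] and the
   [Phi] term each use [e / 4]. *)
have [N N0 HN] : exists2 N, (0 < N)%N & forall n, (N <= n)%N ->
    - ln (q n) / L n < d + e / 2 /\
    B + `|Phi (iter n T x)| <= e / 2 * (n%:R * ln lam).
  have : \forall n \near \oo, (0 < n)%N /\
      - ln (q n) / L n < d + e / 2 /\
      B + `|Phi (iter n T x)| <= e / 2 * (n%:R * ln lam).
    near=> n; have n0 : (0 < n)%N by near: n; exact: nbhs_infty_gt.
    split=> //; split.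
      have : `|d - fine (markov_ratio I0 I1 T mu x n)| < e / 2.
        by near: n; exact: ratio_cvg.
      by rewrite -(prednK n0) ratioE /= ltr_distlC => /andP[].
    have : `|Phi (iter n T x)| <= e / 4 * ln lam * n%:R.
      by near: n; exact: birkhoff_term_sublinear.
    have : B / (e / 4 * ln lam) <= n%:R by near: n; exact: nbhs_infty_ger.
    by rewrite ler_pdivrMr//; lra.
  move=> [N _ HN]; exists N; first exact: (HN N (leqnn N)).1.
  by move=> n Nn; exact: (HN n Nn).2.
have [j0 NE] : exists j, N = j.+1 by exists N.-1; rewrite prednK.
(* The upper limit is at most the supremum over the radii [0 < r < len (J N)]. *)
apply: (@le_trans _ _ (ereal_sup
    ((fun r : R => (lne (mu (ball x r)) * ((ln r)^-1)%:E)%E) @`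
     [set r | 0 < r < len (J N)]))).
  apply: ereal_inf_lbound; exists [set r | 0 < r < len (J N)] => //.
  near=> r; apply/andP; split; near: r; [exact: nbhs_right_gt|].
  by apply: nbhs_right_lt; rewrite NE.
apply: ge_ereal_sup => _ [r /= /andP[r0 rN] <-].
have exk : exists k, (N <= k)%N && (len (J k) < r).
  have lamV1 : `|lam^-1| < 1 by rewrite ger0_norm ?invr_ge0 ?ltW// invf_lt1.
  have : \forall k \near \oo, (N <= k)%N /\ lam^-1 ^+ k < r.
    near=> k; split; first by near: k; exact: nbhs_infty_ge.
    have : `|0 - lam^-1 ^+ k| < r.
      by near: k; have /cvgrPdist_lt := cvg_expr lamV1; exact.
    by rewrite sub0r normrN; apply: le_lt_trans; exact: ler_norm.
  move=> [k0 _ /(_ _ (leqnn k0))[Nk lamk]]; exists k0; rewrite Nk /=.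
  rewrite -(prednK (leq_trans N0 Nk)) in lamk *.
  by apply: le_lt_trans lamk; rewrite exprVn.
(* The least level [k >= N] with [len (J k) < r]. As [r < len (J N)], it exceeds [N], so level
   [k - 1] is still at least [N] and minimality gives [r <= len (J (k - 1))]. *)
case: (ex_minnP exk) => k /andP[Nk kr] kmin.
have {Nk}Nk : (N < k)%N.
  by rewrite ltn_neqAle Nk andbT; apply/eqP => Nkk; move: kr; rewrite -Nkk ltNge ltW.
case: k => [//|[|j]] in Nk kr kmin *; first by move: Nk; rewrite NE.
have Nj : (N <= j.+1)%N by [].
have rj : r <= len (J j.+1).
  rewrite leNgt; apply/negP => jr.
  by have := kmin j.+1; rewrite Nj jr ltnn => /(_ isT).
have Lr : L j.+1 <= - ln r by rewrite lerN2 ler_ln ?posrE.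
have lnr0 : 0 < - ln r by exact: lt_le_trans Lr.
have Jx : J j.+2 x by have [] := bJ j.+1.
have Jball : J j.+2 `<=` ball x r.
  by move=> y Jy; apply: le_lt_trans kr; exact: lenJ.
have muB : mu (ball x r) = (fine (mu (ball x r)))%:E.
  by rewrite fineK// fin_num_measure//; exact: measurable_ball.
have qB : q j.+2 <= fine (mu (ball x r)).
  by rewrite -lee_fin -muB -muJ le_measure// inE//; exact: measurable_ball.
have q0' : 0 < q j.+2 := q0 j.+1.
rewrite muB lne_EFin ?(lt_le_trans q0')// -EFinM -EFinD lee_fin.
have [ratio_lt step_le] := HN _ Nj.
have lnB : - ln (fine (mu (ball x r))) <= - ln (q j.+2).
  by rewrite lerN2 ler_ln ?posrE// (lt_le_trans q0').
(* Both logarithms change sign, which makes the denominator [- ln r] positive. *)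
rewrite -mulrNN -invrN ler_pdivrMr//.
apply: (le_trans lnB); apply: (le_trans (stepB j)).
have m_lt : - ln (q j.+1) < (d + e / 2) * L j.+1 by rewrite -ltr_pdivrMr.
(* This sign allows [L j.+1] to be replaced by the larger [- ln r]. *)
have d0 : 0 <= d + e.
  have : 0 <= - ln (q j.+1) / L j.+1 by rewrite divr_ge0// ltW//; exact: L0.
  by move: ratio_lt; lra.
apply: (@le_trans _ _ ((d + e) * L j.+1)); last by rewrite ler_wpM2l.
(* The Gibbs step is at most [e / 2 * (j.+1%:R * ln lam)], hence at most [e / 2 * L j.+1] by
   expansion. *)
have := L_ge j; rewrite -(ler_pM2l e20) -/(q _).
by rewrite /q /J in m_lt *; lra.
Unshelve. all: by end_near. Qed.
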